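(* Let $\mathbb{K}$ be an algebraically closed field of characteristic zero, $X$ a smooth projective variety over $\mathbb{K}$ with $H^i(X,\mathcal{O}_X)=0$ for $i=1,2$, and $\mathcal{E}$ a locally free sheaf of $\mathcal{O}_X$-modules on $X$. A section $s\in H^0(X,\mathcal{E})$ can be extended to a section of a first order deformation of $\mathcal{E}$ associated to an element $a\in H^1(X,\mathcal{E}nd(\mathcal{E}))$ if and only if $a\cup s=0\in H^1(X,\mathcal{E})$.
   Context: $\mathcal{E}nd(\mathcal{E})$ is the sheaf of $\mathcal{O}_X$-linear endomorphisms of $\mathcal{E}$. A first order deformation of $\mathcal{E}$ is a locally free sheaf $\mathcal{E}_\epsilon$ of $\mathcal{O}_X\otimes\mathbb{K}[\epsilon]$-modules ($\epsilon^2=0$) on $X\times\mathrm{Spec}\,\mathbb{K}[\epsilon]$ with a morphism $\pi:\mathcal{E}_\epsilon\to\mathcal{E}$ inducing $\mathcal{E}_\epsilon\otimes_{\mathbb{K}[\epsilon]}\mathbb{K}\cong\mathcal{E}$; isomorphism classes of such deformations correspond to elements of $H^1(X,\mathcal{E}nd(\mathcal{E}))$ in the standard way (a Čech cocycle $\{a_{ij}\}$ gives the gluing $\mathrm{Id}+\epsilon a_{ij}$). The section $s$ extends if there is a section of $\mathcal{E}_\epsilon$ over $X\times\mathrm{Spec}\,\mathbb{K}[\epsilon]$ mapping to $s$ under $\pi$. The cup product $H^1(X,\mathcal{E}nd(\mathcal{E}))\times H^0(X,\mathcal{E})\to H^1(X,\mathcal{E})$ is induced by the evaluation $\mathcal{E}nd(\mathcal{E})\otimes\mathcal{E}\to\mathcal{E}$.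 *)

(* Defs.v *)
From HB Require Import structures.
From mathcomp Require Import all_boot all_order all_algebra.
From mathcomp Require Import mpoly.
From mathcomp Require Import all_classical topology.

Set Implicit Arguments.
Unset Strict Implicit.
Unset Printing Implicit Defensive.

Import GRing.Theory.
Local Open Scope classical_set_scope.
Local Open Scope ring_scope.

Record opens (X : topologicalType) := Opens {
  oset :> set X;
  open_oset : open oset }.

Definition opensT (X : topologicalType) : opens X := Opens (@openT X).

Definition opensI (X : topologicalType) (U V : opens X) : opens X :=
  Opens (openI (open_oset U) (open_oset V)).

Record ab_presheaf (X : topologicalType) := AbPresheaf {
  ab_sec :> opens X -> zmodType;
  res : forall U V : opens X, V `<=` U -> {additive ab_sec U -> ab_sec V};
  res_id : forall (U : opens X) (h : U `<=` U) m, res h m = m;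
  res_comp : forall (U V W : opens X) (h : V `<=` U) (k : W `<=` V)
    (l : W `<=` U) m, res k (res h m) = res l m }.

(* [exists!] packages both gluing and locality. *)
Definition is_sheaf (X : topologicalType) (F : ab_presheaf X) : Prop :=
  forall (U : opens X) (I : Type) (W : I -> opens X) (h : forall i, W i `<=` U),
  (forall x, oset U x -> exists i, oset (W i) x) ->
  forall m : (forall i, F (W i)),
  (forall i j, res F (@subIsetl _ (W i) (W j) : opensI (W i) (W j) `<=` W i) (m i)
             = res F (@subIsetr _ (W i) (W j) : opensI (W i) (W j) `<=` W j) (m j)) ->
  exists! t : F U, forall i, res F (h i) t = m i.

(* [comPzRingType] rather than [comNzRingType]: the ring of sections over the
   empty set is the zero ring. *)
Record ring_presheaf (X : topologicalType) := RingPresheaf {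
  rsec :> opens X -> comPzRingType;
  rres : forall U V : opens X, V `<=` U -> {rmorphism rsec U -> rsec V};
  rres_id : forall (U : opens X) (h : U `<=` U) a, rres h a = a;
  rres_comp : forall (U V W : opens X) (h : V `<=` U) (k : W `<=` V)
    (l : W `<=` U) a, rres k (rres h a) = rres l a }.

Definition ab_of_ring (X : topologicalType) (O : ring_presheaf X) : ab_presheaf X :=
  @AbPresheaf X (fun U => O U : zmodType) (fun U V h => rres O h)
    (@rres_id X O) (@rres_comp X O).

Record mod_presheaf (X : topologicalType) (O : ring_presheaf X) := ModPresheaf {
  msec :> forall U : opens X, lmodType (O U);
  mres : forall U V : opens X, V `<=` U -> {additive msec U -> msec V};
  mresZ : forall (U V : opens X) (h : V `<=` U) a m,
    mres h (a *: m) = rres O h a *: mres h m;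
  mres_id : forall (U : opens X) (h : U `<=` U) m, mres h m = m;
  mres_comp : forall (U V W : opens X) (h : V `<=` U) (k : W `<=` V)
    (l : W `<=` U) m, mres k (mres h m) = mres l m }.

Definition ab_of_mod (X : topologicalType) (O : ring_presheaf X)
    (M : mod_presheaf O) : ab_presheaf X :=
  @AbPresheaf X (fun U => M U : zmodType) (fun U V h => mres M h)
    (@mres_id X O M) (@mres_comp X O M).

(* Locally free of finite rank: locally M|_U is isomorphic to O|_U ^ n, the
   isomorphism being given by the images e of the standard basis. *)
Definition locally_free (X : topologicalType) (O : ring_presheaf X)
    (M : mod_presheaf O) : Prop :=
  forall x : X, exists U : opens X, oset U x /\
  exists (n : nat) (e : 'I_n -> M U),
  forall (V : opens X) (h : V `<=` U) (m : M V),
  exists! a : 'I_n -> O V, m = \sum_(i < n) a i *: mres M h (e i).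

Record ringed_space (K : fieldType) := RingedSpace {
  space :> topologicalType;
  structure : ring_presheaf space;
  scalar : forall U : opens space, {rmorphism K -> structure U};
  scalar_res : forall (U V : opens space) (h : V `<=` U) c,
    rres structure h (scalar U c) = scalar V c }.

Notation "\O_ X" := (structure X) (at level 8, X at level 2, format "\O_ X").

(* The points of U at which the germ of f is a unit. *)
Definition unit_locus (X : topologicalType) (O : ring_presheaf X) (U : opens X)
    (f : O U) : set X :=
  [set x | exists (V : opens X) (h : V `<=` U), oset V x /\ exists g, rres O h f * g = 1].

Lemma unit_locus_open (X : topologicalType) (O : ring_presheaf X) (U : opens X)
  (f : O U) : open (unit_locus f).
Proof.
rewrite openE => x [V [h [Vx fV]]].
apply: (@filterS _ (nbhs x) _ V); last by apply: open_nbhs_nbhs; split=> //; exact: open_oset.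
by move=> y Vy; exists V, h.
Qed.

Definition basic_open (X : topologicalType) (O : ring_presheaf X) (U : opens X)
  (f : O U) : opens X := Opens (unit_locus_open f).

Lemma basic_open_sub (X : topologicalType) (O : ring_presheaf X) (U : opens X)
  (f : O U) : basic_open f `<=` U.
Proof. by move=> x [V [h [Vx _]]]; exact: h. Qed.

Definition prime_ideal (A : comPzRingType) (P : set A) : Prop :=
  [/\ P 0, forall a b, P a -> P b -> P (a + b), forall a b, P b -> P (a * b),
      ~ P 1 & forall a b, P (a * b) -> P a \/ P b].

(* (U, O|_U) is the spectrum of A = O(U), spelled out as: the canonical map
   from U to Spec A, sending x to the ideal of the sections that are not units
   at x, is well defined and bijective; the sets D(f) form a base of the
   topology of U; and A -> O(D(f)) is the localization of A at f (f is a unit on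
   D(f) by definition of [basic_open]). *)
Definition affine (X : topologicalType) (O : ring_presheaf X) (U : opens X) : Prop :=
  [/\ forall x, oset U x -> prime_ideal [set f : O U | ~ unit_locus f x],
      forall P : set (O U), prime_ideal P ->
        exists! x, oset U x /\ P = [set f : O U | ~ unit_locus f x],
      forall (V : opens X) x, V `<=` U -> oset V x ->
        exists f : O U, unit_locus f x /\ unit_locus f `<=` V,
      forall (f : O U) (g : O (basic_open f)), exists (k : nat) (a : O U),
        g * rres O (@basic_open_sub X O U f) f ^+ k = rres O (@basic_open_sub X O U f) a
    & forall (f a : O U), rres O (@basic_open_sub X O U f) a = 0 ->
        exists k : nat, f ^+ k * a = 0].

Definition is_scheme (K : fieldType) (X : ringed_space K) : Prop :=
  is_sheaf (ab_of_ring \O_X) /\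
  forall x : X, exists U : opens X, oset U x /\ affine \O_X U.

Definition integral (K : fieldType) (X : ringed_space K) : Prop :=
  (exists x : X, True) /\
  forall U : opens X, (exists x, oset U x) ->
  (1 : \O_X U) <> 0 /\ forall f g : \O_X U, f * g = 0 -> f = 0 \/ g = 0.

Definition K_linear (K : fieldType) (X : ringed_space K) (U : opens X) (n : nat)
    (phi : {rmorphism {mpoly K[n]} -> \O_X U}) : Prop :=
  forall c : K, phi c%:MP = scalar U c.

(* Smoothness over K: every point has an affine neighbourhood with a standard
   smooth presentation O(U) = K[x_1..x_m] / (f_1..f_c), i.e. one in which some
   c * c minor of the Jacobian matrix is a unit of O(U). *)
Definition smooth (K : fieldType) (X : ringed_space K) : Prop :=
  forall x : X, exists U : opens X, [/\ oset U x, affine \O_X U &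
  exists (m c : nat) (phi : {rmorphism {mpoly K[m]} -> \O_X U})
    (f : 'I_c -> {mpoly K[m]}) (v : 'I_c -> 'I_m),
  [/\ K_linear phi,
      forall a, exists p, phi p = a,
      forall p, phi p = 0 <->
        exists q : 'I_c -> {mpoly K[m]}, p = \sum_(i < c) q i * f i
    & exists g : \O_X U, phi (\det (\matrix_(i, j) (f i)^`M(v j))) * g = 1]].

(* The projective space P^n over K, obtained by gluing the n+1 affine spaces
   with coordinate rings K[x_0/x_i .. x_n/x_i]; t i j stands for x_j / x_i. *)
Definition is_projective_space (K : fieldType) (n : nat) (P : ringed_space K) : Prop :=
  is_scheme P /\
  exists (U : 'I_n.+1 -> opens P) (t : forall i : 'I_n.+1, 'I_n.+1 -> \O_P (U i)),
  [/\ (forall x : P, exists i, oset (U i) x) /\ (forall i, affine \O_P (U i)),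
      forall i, t i i = 1,
      forall i, exists phi : {rmorphism {mpoly K[n]} -> \O_P (U i)},
        [/\ K_linear phi, bijective phi & forall j : 'I_n, phi 'X_j = t i (lift i j)],
      forall i j, basic_open (t i j) = U i `&` U j :> set P
    & forall i j k,
        rres \O_P (@subIsetl _ (U i) (U j) : opensI (U i) (U j) `<=` U i) (t i k) =
        rres \O_P (@subIsetl _ (U i) (U j) : opensI (U i) (U j) `<=` U i) (t i j) *
        rres \O_P (@subIsetr _ (U i) (U j) : opensI (U i) (U j) `<=` U j) (t j k)].

Definition opens_preim (X Y : topologicalType) (f : X -> Y) (cf : continuous f)
    (V : opens Y) : opens X :=
  Opens ((continuousP f).1 cf V (open_oset V)).

Lemma opens_preim_sub (X Y : topologicalType) (f : X -> Y) (cf : continuous f)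
  (V W : opens Y) : W `<=` V -> opens_preim cf W `<=` opens_preim cf V.
Proof. by move=> h x; exact: h. Qed.

(* Morphisms of locally ringed spaces over K; [mor_local] says that the maps
   induced on the stalks are local. *)
Record morphism (K : fieldType) (X Y : ringed_space K) := Morphism {
  mor_fun :> X -> Y;
  mor_cont : continuous mor_fun;
  mor_sh : forall V : opens Y, {rmorphism \O_Y V -> \O_X (opens_preim mor_cont V)};
  mor_res : forall (V W : opens Y) (h : W `<=` V) a,
    mor_sh W (rres \O_Y h a) = rres \O_X (opens_preim_sub (cf := mor_cont) h) (mor_sh V a);
  mor_scalar : forall (V : opens Y) c, mor_sh V (scalar V c) = scalar _ c;
  mor_local : forall (V : opens Y) (f : \O_Y V) x,
    oset V (mor_fun x) -> unit_locus (mor_sh V f) x -> unit_locus f (mor_fun x) }.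

Arguments mor_cont {K X Y} _ : rename.

(* A homeomorphism onto a closed subset, surjective on structure sheaves. *)
Definition closed_immersion (K : fieldType) (X Y : ringed_space K)
    (i : morphism X Y) : Prop :=
  [/\ injective i, closed (range i),
      forall U : opens X, exists V : opens Y, opens_preim (mor_cont i) V = U :> set X
    & forall (V : opens Y) (g : \O_X (opens_preim (mor_cont i) V)) (y : Y), oset V y ->
      exists (W : opens Y) (h : W `<=` V), oset W y /\
      exists f : \O_Y W,
        mor_sh i W f = rres \O_X (opens_preim_sub (cf := mor_cont i) h) g].

Definition projective (K : fieldType) (X : ringed_space K) : Prop :=
  exists (n : nat) (P : ringed_space K), is_projective_space n P /\
  exists i : morphism X P, closed_immersion i.

Definition smooth_projective_variety (K : fieldType) (X : ringed_space K) : Prop :=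
  [/\ is_scheme X, integral X, smooth X & projective X].

(* Covers are indexed by the points of X, with x in the member of index x.
   They are cofinal among all open covers and form a directed set under
   memberwise inclusion, so that the cohomology of X is the colimit over them. *)
Record cover (X : topologicalType) := Cover {
  cov :> X -> opens X;
  cov_mem : forall x, oset (cov x) x }.

Definition refines (X : topologicalType) (V U : cover X) : Prop :=
  forall x, V x `<=` U x.

Lemma cap_subproof (X : topologicalType) (U : cover X) (p : nat) (s : 'I_p.+1 -> X) :
  open [set y | forall k, oset (U (s k)) y].
Proof.
rewrite openE => y Uy; apply: filter_forall => k.
by apply: open_nbhs_nbhs; split; [exact: open_oset|exact: Uy].
Qed.

Definition cap (X : topologicalType) (U : cover X) (p : nat) (s : 'I_p.+1 -> X) : opens X :=
  Opens (cap_subproof U s).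

Lemma cap_in (X : topologicalType) (U : cover X) (p : nat) (s : 'I_p.+1 -> X) k :
  cap U s `<=` U (s k).
Proof. by move=> y; exact. Qed.

Lemma cap_face (X : topologicalType) (U : cover X) (p : nat) (s : 'I_p.+2 -> X)
  (j : 'I_p.+2) : cap U s `<=` cap U (s \o lift j).
Proof. by move=> y Uy k; exact: Uy. Qed.

Lemma cap_refines (X : topologicalType) (U V : cover X) (h : refines V U) (p : nat)
  (s : 'I_p.+1 -> X) : cap V s `<=` cap U s.
Proof. by move=> y Vy k; apply: h; exact: Vy. Qed.

Arguments cap_in {X} U {p} s k.
Arguments cap_face {X} U {p} s j.
Arguments cap_refines {X U V} h {p} s.

Definition cochain (X : topologicalType) (F : ab_presheaf X) (U : cover X) (p : nat) :=
  forall s : 'I_p.+1 -> X, F (cap U s).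

Definition cech_d (X : topologicalType) (F : ab_presheaf X) (U : cover X) (p : nat)
    (c : cochain F U p) : cochain F U p.+1 :=
  fun s => \sum_(j < p.+2) res F (cap_face U s j) (c (s \o lift j)) *~ (-1) ^+ j.

Definition cochain_res (X : topologicalType) (F : ab_presheaf X) (U V : cover X)
    (h : refines V U) (p : nat) (c : cochain F U p) : cochain F V p :=
  fun s => res F (cap_refines h s) (c s).

Record cocycle (X : topologicalType) (F : ab_presheaf X) (p : nat) := Cocycle {
  coc_cover : cover X;
  coc :> cochain F coc_cover p;
  coc_d : forall s, cech_d coc s = 0 }.

Definition is_coboundary (X : topologicalType) (F : ab_presheaf X) (U : cover X)
    (p : nat) : cochain F U p -> Prop :=
  match p with
  | 0 => fun c => forall s, c s = 0
  | q.+1 => fun c => exists b : cochain F U q, forall s, c s = cech_d b s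
  end.

Definition cohomologous (X : topologicalType) (F : ab_presheaf X) (p : nat)
    (z w : cocycle F p) : Prop :=
  exists (V : cover X) (hz : refines V (coc_cover z)) (hw : refines V (coc_cover w)),
  is_coboundary (fun s => cochain_res hz z s - cochain_res hw w s).

(* H^p(X, F): the set of equivalence classes of [cohomologous]. *)
Definition cohomology (X : topologicalType) (F : ab_presheaf X) (p : nat) : Type :=
  {C : set (cocycle F p) | exists z, C = cohomologous z}.

Notation "''H^' p ( F )" := (cohomology F p)
  (at level 8, p at level 2, format "''H^' p ( F )").

Definition class (X : topologicalType) (F : ab_presheaf X) (p : nat)
    (z : cocycle F p) : 'H^p(F) :=
  exist _ (cohomologous z) (ex_intro _ z erefl).

Definition repr_cocycle (X : topologicalType) (F : ab_presheaf X) (p : nat)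
    (a : 'H^p(F)) : cocycle F p :=
  sval (cid (svalP a)).

Definition cover0 (X : topologicalType) : cover X :=
  @Cover X (fun _ => opensT X) (fun _ => I).

Lemma cocycle0_subproof (X : topologicalType) (F : ab_presheaf X) (p : nat) s :
  cech_d (fun s => 0 : F (@cap X (cover0 X) p s)) s = 0.
Proof. by rewrite /cech_d big1// => j _; rewrite raddf0 mul0rz. Qed.

Definition cocycle0 (X : topologicalType) (F : ab_presheaf X) (p : nat) : cocycle F p :=
  Cocycle (@cocycle0_subproof X F p).

Definition zero_class (X : topologicalType) (F : ab_presheaf X) (p : nat) : 'H^p(F) :=
  class (cocycle0 F p).

Definition cohomology_vanishes (X : topologicalType) (F : ab_presheaf X) (p : nat) : Prop :=
  forall a : 'H^p(F), a = zero_class F p.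

(* Sections over U of the sheaf of O-linear endomorphisms of M: the O|_U-linear
   endomorphisms of M|_U. *)
Record endo (X : topologicalType) (O : ring_presheaf X) (M : mod_presheaf O)
    (U : opens X) := Endo {
  endo_fun : forall V : opens X, V `<=` U -> M V -> M V;
  endo_linear : forall (V : opens X) (h : V `<=` U) (a : O V) m n,
    endo_fun h (a *: m + n) = a *: endo_fun h m + endo_fun h n;
  endo_res : forall (V W : opens X) (h : V `<=` U) (k : W `<=` V) (l : W `<=` U) m,
    mres M k (endo_fun h m) = endo_fun l (mres M k m) }.

Section EndoZmod.
Variables (X : topologicalType) (O : ring_presheaf X) (M : mod_presheaf O).
Implicit Types U V W : opens X.

Lemma endo_eq U (f g : endo M U) :
  (forall V (h : V `<=` U) m, endo_fun f h m = endo_fun g h m) -> f = g.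
Proof.
case: f g => [f lf rf] [g lg rg] /= fg.
have {}fg : f = g by apply: functional_extensionality_dep => V;
  apply: functional_extensionality_dep => h; apply/funext => m; exact: fg.
by subst g; congr Endo; exact: Prop_irrelevance.
Qed.

Definition endo0 U : endo M U.
Proof.
apply: (@Endo _ _ _ U (fun V _ _ => 0)) => [V h a m n|V W h k l m].
  by rewrite scaler0 addr0.
by rewrite raddf0.
Defined.

Definition endo_opp U (f : endo M U) : endo M U.
Proof.
apply: (@Endo _ _ _ U (fun V h m => - endo_fun f h m)) => [V h a m n|V W h k l m].
  by rewrite endo_linear opprD scalerN.
by rewrite raddfN (endo_res f h k l).
Defined.

Definition endo_add U (f g : endo M U) : endo M U.
Proof.
apply: (@Endo _ _ _ U (fun V h m => endo_fun f h m + endo_fun g h m))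
  => [V h a m n|V W h k l m].
  by rewrite !endo_linear scalerDr addrACA.
by rewrite raddfD /= (endo_res f h k l) (endo_res g h k l).
Defined.

HB.instance Definition _ U := gen_eqMixin (endo M U).
HB.instance Definition _ U := gen_choiceMixin (endo M U).

Lemma endo_addA U : associative (@endo_add U).
Proof. by move=> f g k; apply: endo_eq => V h m /=; rewrite addrA. Qed.
Lemma endo_addC U : commutative (@endo_add U).
Proof. by move=> f g; apply: endo_eq => V h m /=; rewrite addrC. Qed.
Lemma endo_add0 U : left_id (endo0 U) (@endo_add U).
Proof. by move=> f; apply: endo_eq => V h m /=; rewrite add0r. Qed.
Lemma endo_addN U : left_inverse (endo0 U) (@endo_opp U) (@endo_add U).
Proof. by move=> f; apply: endo_eq => V h m /=; rewrite addNr. Qed.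

HB.instance Definition _ U :=
  GRing.isZmodule.Build (endo M U) (@endo_addA U) (@endo_addC U) (@endo_add0 U) (@endo_addN U).

Definition endo_restr U V (h : V `<=` U) (f : endo M U) : endo M V :=
  @Endo _ _ M V (fun W k => endo_fun f (subset_trans k h))
    (fun W k => endo_linear f (subset_trans k h))
    (fun W W' k l l' => endo_res f (subset_trans k h) l (subset_trans l' h)).

Lemma endo_restr_additive U V (h : V `<=` U) : zmod_morphism (endo_restr h).
Proof. by move=> f g; apply: endo_eq => W k m. Qed.

HB.instance Definition _ U V (h : V `<=` U) :=
  GRing.isZmodMorphism.Build (endo M U) (endo M V) (endo_restr h) (endo_restr_additive h).

Lemma endo_restr_id U (h : U `<=` U) f : endo_restr h f = f.
Proof.
by apply: endo_eq => W k m /=; rewrite (Prop_irrelevance (subset_trans k h) k).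
Qed.

Lemma endo_restr_comp U V W (h : V `<=` U) (k : W `<=` V) (l : W `<=` U) f :
  endo_restr k (endo_restr h f) = endo_restr l f.
Proof.
apply: endo_eq => Z i m /=.
by rewrite (Prop_irrelevance (subset_trans (subset_trans i k) h) (subset_trans i l)).
Qed.

Definition End_sheaf : ab_presheaf X :=
  @AbPresheaf X (fun U => endo M U : zmodType)
    (fun U V h => endo_restr h : {additive endo M U -> endo M V})
    endo_restr_id endo_restr_comp.

End EndoZmod.

(* [Dual a b] stands for a + eps b, where eps ^ 2 = 0. *)
Record dual (A : Type) := Dual { re : A; im : A }.

Definition pair_of_dual A (x : dual A) : A * A := (re x, im x).
Definition dual_of_pair A (x : A * A) : dual A := Dual x.1 x.2.
Lemma pair_of_dualK A : cancel (@pair_of_dual A) (@dual_of_pair A).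
Proof. by case. Qed.

HB.instance Definition _ (A : choiceType) :=
  Choice.copy (dual A) (can_type (@pair_of_dualK A)).

Section DualZmod.
Variable A : zmodType.
Definition dual_add (x y : dual A) := Dual (re x + re y) (im x + im y).
Definition dual_opp (x : dual A) := Dual (- re x) (- im x).
Lemma dual_addA : associative dual_add.
Proof. by move=> *; rewrite /dual_add /= !addrA. Qed.
Lemma dual_addC : commutative dual_add.
Proof. by move=> x y; rewrite /dual_add addrC [im x + _]addrC. Qed.
Lemma dual_add0 : left_id (Dual 0 0) dual_add.
Proof. by case=> a b; rewrite /dual_add /= !add0r. Qed.
Lemma dual_addN : left_inverse (Dual 0 0) dual_opp dual_add.
Proof. by case=> a b; rewrite /dual_add /= !addNr. Qed.
HB.instance Definition _ :=
  GRing.isZmodule.Build (dual A) dual_addA dual_addC dual_add0 dual_addN.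
End DualZmod.

Section DualRing.
Variable A : comPzRingType.
Definition dual_mul (x y : dual A) := Dual (re x * re y) (re x * im y + im x * re y).
Lemma dual_mulA : associative dual_mul.
Proof.
by move=> x y z; rewrite /dual_mul /= !mulrA mulrDr mulrDl !mulrA addrA.
Qed.
Lemma dual_mulC : commutative dual_mul.
Proof.
by move=> x y; rewrite /dual_mul mulrC addrC [im x * _]mulrC [re x * _]mulrC.
Qed.
Lemma dual_mul1 : left_id (Dual 1 0) dual_mul.
Proof. by case=> a b; rewrite /dual_mul /= !mul1r mul0r addr0. Qed.
Lemma dual_mulDl : left_distributive dual_mul +%R.
Proof.
move=> x y z; rewrite /dual_mul /= mulrDl mulrDl mulrDl /GRing.add /= /dual_add /=.
by rewrite addrACA.
Qed.
HB.instance Definition _ :=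
  GRing.Zmodule_isComPzRing.Build (dual A) dual_mulA dual_mulC dual_mul1 dual_mulDl.
End DualRing.

Section DualMod.
Variables (A : comPzRingType) (M : lmodType A).
Definition dual_scale (a : dual A) (m : dual M) :=
  Dual (re a *: re m) (re a *: im m + im a *: re m).
Lemma dual_scaleA a b m : dual_scale a (dual_scale b m) = dual_scale (a * b) m.
Proof. by rewrite /dual_scale /= !scalerDr !scalerDl !scalerA addrA. Qed.
Lemma dual_scale1 : left_id 1 dual_scale.
Proof. by case=> a b; rewrite /dual_scale /= !scale1r scale0r addr0. Qed.
Lemma dual_scaleDr : right_distributive dual_scale +%R.
Proof.
move=> a m n; rewrite /dual_scale /= !scalerDr.
by rewrite /GRing.add /= /dual_add /= addrACA.
Qed.
Lemma dual_scaleDl m : {morph dual_scale^~ m : a b / a + b}.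
Proof.
move=> a b; rewrite /dual_scale /= !scalerDl.
by rewrite /GRing.add /= /dual_add /= addrACA.
Qed.
HB.instance Definition _ :=
  GRing.Zmodule_isLmodule.Build (dual A) (dual M)
    dual_scaleA dual_scale1 dual_scaleDr dual_scaleDl.
End DualMod.

Definition dual_map A B (f : A -> B) (x : dual A) := Dual (f (re x)) (f (im x)).

Section DualMapAdditive.
Variables (A B : zmodType) (f : {additive A -> B}).
Lemma dual_map_additive : zmod_morphism (dual_map f).
Proof. by move=> x y; rewrite /dual_map /= !raddfB. Qed.
HB.instance Definition _ :=
  GRing.isZmodMorphism.Build (dual A) (dual B) (dual_map f) dual_map_additive.
End DualMapAdditive.

Section DualMapRing.
Variables (A B : comPzRingType) (f : {rmorphism A -> B}).
Lemma dual_map_multiplicative : monoid_morphism (dual_map f).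
Proof.
split=> [|x y]; first by rewrite /dual_map /= rmorph1 rmorph0.
by rewrite /dual_map /= rmorphD /= !rmorphM.
Qed.
HB.instance Definition _ :=
  GRing.isMonoidMorphism.Build (dual A) (dual B) (dual_map f) dual_map_multiplicative.
End DualMapRing.

Section DualSheaf.
Variables (X : topologicalType) (O : ring_presheaf X).

Lemma dual_rres_id (U : opens X) (h : U `<=` U) (a : dual (O U)) :
  dual_map (rres O h) a = a.
Proof. by case: a => a b; congr Dual; exact: rres_id. Qed.

Lemma dual_rres_comp (U V W : opens X) (h : V `<=` U) (k : W `<=` V) (l : W `<=` U)
  (a : dual (O U)) :
  dual_map (rres O k) (dual_map (rres O h) a) = dual_map (rres O l) a.
Proof. by congr Dual; exact: rres_comp. Qed.

(* The structure sheaf of the product of X with Spec K[eps], whose underlying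
   space is that of X: the tensor product of O with K[eps] over K. *)
Definition dual_sheaf : ring_presheaf X :=
  @RingPresheaf X (fun U => dual (O U) : comPzRingType)
    (fun U V h => dual_map (rres O h) : {rmorphism dual (O U) -> dual (O V)})
    dual_rres_id dual_rres_comp.

Definition eps (U : opens X) : dual_sheaf U := Dual 0 1.

End DualSheaf.

Section Deformation.
Variables (X : topologicalType) (O : ring_presheaf X) (E : mod_presheaf O).

(* The sheaf induced by D (tensored over K[eps] with K) is the cokernel of the
   multiplication by eps, i.e. the sheafification of D(U) / eps D(U); [def_surj] and
   [def_ker] say that the map it induces to E is an isomorphism of sheaves. *)
Record deformation := Deformation {
  def_sh :> mod_presheaf (dual_sheaf O);
  def_is_sheaf : is_sheaf (ab_of_mod def_sh);
  def_locally_free : locally_free def_sh;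
  def_pi : forall U : opens X, {additive def_sh U -> E U};
  def_piZ : forall (U : opens X) (a : dual (O U)) (m : def_sh U),
    def_pi U (a *: m) = re a *: def_pi U m;
  def_pi_res : forall (U V : opens X) (h : V `<=` U) (m : def_sh U),
    def_pi V (mres def_sh h m) = mres E h (def_pi U m);
  def_surj : forall (U : opens X) (m : E U) x, oset U x ->
    exists (V : opens X) (h : V `<=` U), oset V x /\ exists t, def_pi V t = mres E h m;
  def_ker : forall (U : opens X) (t : def_sh U), def_pi U t = 0 <->
    forall x, oset U x -> exists (V : opens X) (h : V `<=` U), oset V x /\
      exists t', mres def_sh h t = eps O V *: t' }.

(* An isomorphism over U of the trivial deformation E + eps E with D. *)
Record trivialization (D : deformation) (U : opens X) := Trivialization {
  triv : forall V : opens X, V `<=` U -> {additive dual (E V) -> D V};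
  trivZ : forall (V : opens X) (h : V `<=` U) (a : dual (O V)) (m : dual (E V)),
    triv h (a *: m) = (a : dual_sheaf O V) *: triv h m;
  triv_bij : forall (V : opens X) (h : V `<=` U), bijective (triv h);
  triv_res : forall (V W : opens X) (h : V `<=` U) (k : W `<=` V) (l : W `<=` U) m,
    mres D k (triv h m) = triv l (dual_map (mres E k) m);
  triv_pi : forall (V : opens X) (h : V `<=` U) m, def_pi D V (triv h m) = re m }.

(* D is associated to the class a when it is glued from trivial deformations
   phi_x on a cover with transition maps phi_x^-1 phi_y = Id + eps z_xy, for a
   cocycle z of class a. *)
Definition associated (D : deformation) (a : 'H^1(End_sheaf E)) : Prop :=
  exists z : cocycle (End_sheaf E) 1, class z = a /\
  exists phi : (forall x : X, trivialization D (coc_cover z x)),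
  forall (s : 'I_2 -> X) (V : opens X) (h : V `<=` cap (coc_cover z) s) (m : dual (E V)),
    triv (phi (s ord_max)) (subset_trans h (cap_in _ s ord_max)) m =
    triv (phi (s ord0)) (subset_trans h (cap_in _ s ord0))
      (m + Dual 0 (endo_fun (coc z s) h (re m))).

Definition extends_to (D : deformation) (s : E (opensT X)) : Prop :=
  exists t : D (opensT X), def_pi D (opensT X) t = s.

End Deformation.

Section CohomologyEquivalence.
Variables (X : topologicalType) (F : ab_presheaf X) (p : nat).

Lemma cochain_resB (U V : cover X) (h : refines V U) q (c d : cochain F U q) s :
  cochain_res h (fun i => c i - d i) s = cochain_res h c s - cochain_res h d s.
Proof. exact: raddfB. Qed.

Lemma cochain_res_comp (U V W : cover X) (h : refines V U) (k : refines W V)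
  (l : refines W U) q (c : cochain F U q) s :
  cochain_res k (cochain_res h c) s = cochain_res l c s.
Proof. exact: res_comp. Qed.

Lemma cech_d_res (U V : cover X) (h : refines V U) q (c : cochain F U q) s :
  cech_d (cochain_res h c) s = cochain_res h (cech_d c) s.
Proof.
rewrite /cochain_res /cech_d raddf_sum; apply: eq_bigr => j _.
rewrite raddfMz; congr (_ *~ _).
by rewrite (res_comp _ _ (subset_trans (cap_face V s j) (cap_refines h (s \o lift j))))
  (res_comp _ _ (subset_trans (cap_face V s j) (cap_refines h (s \o lift j)))).
Qed.

Lemma cech_dB (U : cover X) q (c d : cochain F U q) s :
  cech_d (fun i => c i - d i) s = cech_d c s - cech_d d s.
Proof.
by rewrite /cech_d -sumrB; apply: eq_bigr => j _; rewrite raddfB mulrzBl.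
Qed.

Lemma coboundary_res (U V : cover X) (h : refines V U) (c : cochain F U p) :
  is_coboundary c -> is_coboundary (cochain_res h c).
Proof.
case: p c => [c c0 s|q c [b cb]]; first by rewrite /cochain_res c0 raddf0.
by exists (cochain_res h b) => s; rewrite cech_d_res /cochain_res cb.
Qed.

Lemma coboundaryB (U : cover X) (c d : cochain F U p) :
  is_coboundary c -> is_coboundary d -> is_coboundary (fun s => c s - d s).
Proof.
case: p c d => [c d c0 d0 s|q c d [b cb] [b' db']]; first by rewrite c0 d0 subr0.
by exists (fun i => b i - b' i) => s; rewrite cech_dB cb db'.
Qed.

Lemma coboundary0 (U : cover X) : is_coboundary (fun s => 0 : F (@cap X U p s)).
Proof.
case: p => [//|q]; exists (fun=> 0) => s.
by rewrite /cech_d big1// => j _; rewrite raddf0 mul0rz.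
Qed.

Lemma coboundary_ext (U : cover X) (c d : cochain F U p) :
  (forall s, c s = d s) -> is_coboundary c -> is_coboundary d.
Proof. by move=> cd; have -> : c = d by apply: functional_extensionality_dep. Qed.

Lemma cohomologous_refl (z : cocycle F p) : cohomologous z z.
Proof.
exists (coc_cover z), (fun=> @subset_refl _ _), (fun=> @subset_refl _ _).
by apply: coboundary_ext (coboundary0 _) => s; rewrite subrr.
Qed.

Lemma cohomologous_sym (z w : cocycle F p) : cohomologous z w -> cohomologous w z.
Proof.
move=> [V [hz [hw zw]]]; exists V, hw, hz.
apply: coboundary_ext (coboundaryB (coboundary0 _) zw) => s /=.
by rewrite sub0r opprB.
Qed.

Definition cover_meet (U V : cover X) : cover X :=
  @Cover X (fun x => opensI (U x) (V x)) (fun x => conj (cov_mem U x) (cov_mem V x)).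

Lemma cohomologous_trans (y z w : cocycle F p) :
  cohomologous y z -> cohomologous z w -> cohomologous y w.
Proof.
move=> [U [hy [hz yz]]] /cohomologous_sym[V [hw [hz' wz]]].
have hU : refines (cover_meet U V) U by move=> x; exact: subIsetl.
have hV : refines (cover_meet U V) V by move=> x; exact: subIsetr.
exists (cover_meet U V), (fun x => subset_trans (hU x) (hy x)),
  (fun x => subset_trans (hV x) (hw x)).
apply: coboundary_ext (coboundaryB (coboundary_res hU yz) (coboundary_res hV wz)) => s.
rewrite (cochain_resB hU (cochain_res hy y)) (cochain_resB hV (cochain_res hw w)).
pose k := fun x => subset_trans (hU x) (hz x).
rewrite (cochain_res_comp hz hU k) (cochain_res_comp hz' hV k).
rewrite (cochain_res_comp hy hU (fun x => subset_trans (hU x) (hy x))).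
rewrite (cochain_res_comp hw hV (fun x => subset_trans (hV x) (hw x))).
by rewrite opprB addrA subrK.
Qed.

Lemma class_eq (z w : cocycle F p) : class z = class w <-> cohomologous z w.
Proof.
split=> [|zw]; first by move=> /(congr1 sval) /= ->; exact: cohomologous_refl.
apply: eq_exist; apply/seteqP; split=> y; last exact: cohomologous_trans.
by apply: cohomologous_trans; exact: cohomologous_sym.
Qed.

Lemma repr_cocycleK (a : 'H^p(F)) : class (repr_cocycle a) = a.
Proof.
case: a => C hC; rewrite /repr_cocycle; case: cid => z /= Cz.
exact: eq_exist.
Qed.

End CohomologyEquivalence.

Section CupProduct.
Variables (X : topologicalType) (O : ring_presheaf X) (E : mod_presheaf O) (p : nat).
Implicit Types t : E (opensT X).

Definition cup_cochain (U : cover X) q (c : cochain (End_sheaf E) U q) t :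
    cochain (ab_of_mod E) U q :=
  fun s => endo_fun (c s) (@subset_refl _ (cap U s))
             (mres E (@subsetT _ (cap U s) : cap U s `<=` opensT X) t).

Definition endo_eval (U V : opens X) (h : V `<=` U) (m : E V) (f : endo E U) : E V :=
  endo_fun f h m.

Lemma endo_eval_additive (U V : opens X) (h : V `<=` U) (m : E V) :
  zmod_morphism (endo_eval h m).
Proof. by []. Qed.

HB.instance Definition _ (U V : opens X) (h : V `<=` U) (m : E V) :=
  GRing.isZmodMorphism.Build (endo E U) (E V) (endo_eval h m) (endo_eval_additive h m).

Lemma cech_d_cup (U : cover X) q (c : cochain (End_sheaf E) U q) t s :
  cech_d (cup_cochain c t) s = cup_cochain (cech_d c) t s.
Proof.
rewrite /cup_cochain -/(endo_eval _ _ _) /cech_d raddf_sum.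
apply: eq_bigr => j _; rewrite raddfMz; congr (_ *~ _).
rewrite /= /endo_eval /= (endo_res _ _ (cap_face U s j) (cap_face U s j)).
rewrite (mres_comp _ _ (@subsetT _ (cap U s) : cap U s `<=` opensT X)).
by congr (endo_fun _ _ _); exact: Prop_irrelevance.
Qed.

Lemma cup_cochainB (U : cover X) q (c d : cochain (End_sheaf E) U q) t s :
  cup_cochain (fun i => c i - d i) t s = cup_cochain c t s - cup_cochain d t s.
Proof. exact: endo_eval_additive. Qed.

Lemma cup_cochain_res (U V : cover X) (h : refines V U) q
  (c : cochain (End_sheaf E) U q) t s :
  cup_cochain (cochain_res h c) t s = cochain_res h (cup_cochain c t) s.
Proof.
rewrite /cochain_res /cup_cochain /= (endo_res _ _ (cap_refines h s) (cap_refines h s)).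
rewrite (mres_comp _ _ (@subsetT _ (cap V s) : cap V s `<=` opensT X)).
by congr (endo_fun _ _ _); exact: Prop_irrelevance.
Qed.

Lemma cup_cocycle_subproof (z : cocycle (End_sheaf E) p) t s :
  cech_d (cup_cochain z t) s = 0.
Proof.
rewrite cech_d_cup /cup_cochain (_ : cech_d z = fun=> 0) //.
by apply: functional_extensionality_dep => i; exact: coc_d.
Qed.

Definition cup_cocycle (z : cocycle (End_sheaf E) p) t : cocycle (ab_of_mod E) p :=
  Cocycle (cup_cocycle_subproof z t).

Definition cup (a : 'H^p(End_sheaf E)) t : 'H^p(ab_of_mod E) :=
  class (cup_cocycle (repr_cocycle a) t).

Lemma cohomologous_cup (z w : cocycle (End_sheaf E) p) t :
  cohomologous z w -> cohomologous (cup_cocycle z t) (cup_cocycle w t).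
Proof.
move=> [V [hz [hw zw]]]; exists V, hz, hw.
have : is_coboundary
    (cup_cochain (fun s => cochain_res hz z s - cochain_res hw w s) t).
  case: p z w hz hw zw => [z w hz hw zw s|q z w hz hw [b zw]].
    by rewrite /cup_cochain zw.
  exists (cup_cochain b t) => s; rewrite cech_d_cup /cup_cochain zw.
  by [].
by apply: coboundary_ext => s; rewrite cup_cochainB !cup_cochain_res.
Qed.

Lemma cup_class (z : cocycle (End_sheaf E) p) t :
  cup (class z) t = class (cup_cocycle z t).
Proof.
by apply/class_eq/cohomologous_cup/class_eq; exact: repr_cocycleK.
Qed.

End CupProduct.

(* Main.v *)
(* Over the cover of a cocycle z, a section of the deformation lifting s amounts to
   local sections s + eps b_x whose corrections satisfy b_x - b_y = z_xy(s), i.e. to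
   a cochain whose coboundary is -z(s); hence lifts exist iff the cup product
   vanishes, by gluing when the cochain lives on a finer cover. A deformation
   associated to z exists for every z: its sections over W are the pairs of r in
   E(W) and a family of corrections b_x in E(W cap U_x) with b_x - b_y = z_xy(r). *)

From HB Require Import structures.
Require Import Defs.
From mathcomp Require Import all_boot all_order all_algebra.
From mathcomp Require Import mpoly.
From mathcomp Require Import all_classical topology.

Set Implicit Arguments.
Unset Strict Implicit.
Unset Printing Implicit Defensive.

Import GRing.Theory.
Local Open Scope ring_scope.

(** * Restrictions, separation of sheaves, linearity of endomorphisms *)

Lemma res_trans (X : topologicalType) (F : ab_presheaf X) (U V W : opens X)
  (h : (V `<=` U)%classic) (k : (W `<=` V)%classic) (m : F U) :
  res F k (res F h m) = res F (subset_trans k h) m.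
Proof. exact: res_comp. Qed.

(** Both sections glue the family of restrictions of [t] to the chosen neighbourhoods, so the
    uniqueness half of [exists!] identifies them. *)
Lemma sheaf_separated (X : topologicalType) (F : ab_presheaf X) (sF : is_sheaf F)
  (U : opens X) (t t' : F U) :
  (forall x, oset U x -> exists (V : opens X) (h : (V `<=` U)%classic),
     oset V x /\ res F h t = res F h t') ->
  t = t'.
Proof.
move=> tt'.
pose I := {x | oset U x}.
pose W (i : I) := projT1 (cid (tt' _ (svalP i))).
pose h (i : I) := projT1 (cid (projT2 (cid (tt' _ (svalP i))))).
have [||u [_ uu]] := sF U I W h _ (fun i => res F (h i) t).
- by move=> x Ux; exists (exist _ x Ux); rewrite /W; case: cid => ? [? []].
- move=> i j.
  by rewrite !res_trans; congr (res F _ t); exact: Prop_irrelevance.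
rewrite -(uu t)// -(uu t')// => i.
by have [_ ->] := projT2 (cid (projT2 (cid (tt' _ (svalP i))))).
Qed.

Section Restriction.
Variables (X : topologicalType) (O : ring_presheaf X) (M : mod_presheaf O).
Implicit Types U V W : opens X.

Lemma mres_trans U V W (h : (V `<=` U)%classic) (k : (W `<=` V)%classic) (m : M U) :
  mres M k (mres M h m) = mres M (subset_trans k h) m.
Proof. exact: mres_comp. Qed.

Lemma mres_irrelevance U V (h k : (V `<=` U)%classic) (m : M U) : mres M h m = mres M k m.
Proof. by rewrite (Prop_irrelevance h k). Qed.

Lemma subI U V W : (W `<=` U)%classic -> (W `<=` V)%classic -> (W `<=` opensI U V)%classic.
Proof. by move=> h k x Wx; split; [exact: h|exact: k]. Qed.

Definition subIl U V : (opensI U V `<=` U)%classic := @subIsetl _ U V.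

Definition subIr U V : (opensI U V `<=` V)%classic := @subIsetr _ U V.

Lemma endo_funD U V (f : endo M U) (h : (V `<=` U)%classic) m n :
  endo_fun f h (m + n) = endo_fun f h m + endo_fun f h n.
Proof. by rewrite -[m in LHS]scale1r endo_linear scale1r. Qed.

Lemma endo_fun0 U V (f : endo M U) (h : (V `<=` U)%classic) : endo_fun f h 0 = 0.
Proof. by apply: (addIr (endo_fun f h 0)); rewrite -endo_funD !add0r. Qed.

Lemma endo_funZ U V (f : endo M U) (h : (V `<=` U)%classic) a m :
  endo_fun f h (a *: m) = a *: endo_fun f h m.
Proof. by rewrite -[a *: m]addr0 endo_linear endo_fun0 addr0. Qed.

End Restriction.

Lemma dual_sum (A : zmodType) (n : nat) (r q : 'I_n -> A) :
  Dual (\sum_(i < n) r i) (\sum_(i < n) q i) = \sum_(i < n) Dual (r i) (q i).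
Proof. by apply: (big_rec3 (fun x y z => Dual x y = z)) => // i x y _ _ <-. Qed.

(** * The Čech differential from degree 0 to degree 1 *)

Section CechPairs.
Variables (X : topologicalType).

Definition pair_index (x y : X) : 'I_2 -> X := fun k => if k == ord0 then x else y.

Lemma pair_index_eta (s : 'I_2 -> X) : s = pair_index (s ord0) (s ord_max).
Proof.
apply/funext => k; rewrite /pair_index; case: eqP => [->//|].
by case: k => [[|[|//]] hk] k0; [case: k0; exact: val_inj|congr (s _); exact: val_inj].
Qed.

Lemma sub_cap_pair (U : Defs.cover X) x y (V : opens X) :
  (V `<=` U x)%classic -> (V `<=` U y)%classic -> (V `<=` cap U (pair_index x y))%classic.
Proof. by move=> h k v Vv i; rewrite /pair_index; case: eqP => _; [exact: h|exact: k]. Qed.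

Lemma sub_cap_point (U : Defs.cover X) x : (U x `<=` cap U (fun _ : 'I_1 => x))%classic.
Proof. by move=> y Uy k. Qed.

(** Deleting index 0 leaves [s ord_max] and deleting index 1 leaves [s ord0], which fixes the signs.
    Stating it after restriction to [V], with free inclusions [hx] and [hy], makes it usable on any
    open set inside the overlap. *)
Lemma cech_d0E (F : ab_presheaf X) (U : Defs.cover X) (b : cochain F U 0) (s : 'I_2 -> X)
  (V : opens X) (h : (V `<=` cap U s)%classic) (hx : (V `<=` U (s ord0))%classic)
  (hy : (V `<=` U (s ord_max))%classic) :
  res F h (cech_d b s) =
  res F (subset_trans hy (@sub_cap_point U (s ord_max))) (b (fun=> s ord_max))
  - res F (subset_trans hx (@sub_cap_point U (s ord0))) (b (fun=> s ord0)).
Proof.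
rewrite /cech_d big_ord_recl big_ord1 /= expr0 expr1 raddfD /= !raddfMz mulr1z mulrN1z.
have e (t t' : 'I_1 -> X) (k : (V `<=` cap U t)%classic) (k' : (V `<=` cap U t')%classic) :
    t = t' -> res F k (b t) = res F k' (b t').
  by move=> tt'; subst t'; rewrite (Prop_irrelevance k k').
congr (_ - _); rewrite res_trans; apply: e;
  by apply/funext => i; congr (s _); apply: val_inj; rewrite /= (ord1 i).
Qed.

End CechPairs.

(** * Lifts of a section and coboundaries of its cup product *)

Section Extension.
Variables (X : topologicalType) (O : ring_presheaf X) (E : mod_presheaf O).
Variables (D : deformation E) (s : E (opensT X)).

Let srestr (V : opens X) : E V := mres E (@subsetT _ V : (V `<=` opensT X)%classic) s.

Lemma srestr_res (U V : opens X) (h : (V `<=` U)%classic) :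
  mres E h (srestr U) = srestr V.
Proof. exact: mres_comp. Qed.

Section Transition.
Variables (z : cocycle (End_sheaf E) 1) (phi : forall x, trivialization D (coc_cover z x)).
Hypothesis hphi :
  forall (s : 'I_2 -> X) (V : opens X) (h : (V `<=` cap (coc_cover z) s)%classic)
    (m : dual (E V)),
    triv (phi (s ord_max)) (subset_trans h (cap_in _ s ord_max)) m =
    triv (phi (s ord0)) (subset_trans h (cap_in _ s ord0))
      (m + Dual 0 (endo_fun (coc z s) h (re m))).

(** Over each member of the cover, [t] is phi_x(s + eps b_x). Since phi_y(s + eps b_y) = phi_x(s +
    eps (b_y + z_xy(s))), it follows that z_xy(s) = b_x - b_y. *)
Lemma cup_coboundary_of_extends : extends_to D s -> is_coboundary (cup_cochain z s).
Proof.
case=> t ts.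
have b x : {b : E (coc_cover z x) |
    triv (phi x) (@subset_refl _ _) (Dual (srestr _) b) =
    mres D (@subsetT _ (coc_cover z x) : (_ `<=` opensT X)%classic) t}.
  apply: cid.
  have [g _ gK] := triv_bij (phi x) (@subset_refl _ _).
  set tx := mres D _ t; exists (im (g tx)).
  (* The real part of [g tx] is [s], because trivializations are compatible with [def_pi]; only the
     coefficient of eps is free. *)
  have <- : g tx = Dual (srestr (coc_cover z x)) (im (g tx)); last exact: gK.
  case e : (g tx) => [r i] /=; congr Dual.
  have := triv_pi (phi x) (@subset_refl _ _) (g tx).
  by rewrite gK /tx def_pi_res ts e /=.
(* The sign is forced: the differential of -b at (x, y) is b_x - b_y. *)
exists (fun i => - mres E (cap_in _ i ord0) (sval (b (i ord0)))) => i.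
have hx := cap_in (coc_cover z) i ord0; have hy := cap_in (coc_cover z) i ord_max.
have := cech_d0E (F := ab_of_mod E)
  (fun i => - mres E (cap_in _ i ord0) (sval (b (i ord0)))) (@subset_refl _ _) hx hy.
rewrite res_id => ->.
rewrite /= !raddfN /= !mres_trans opprK addrC.
rewrite !(Prop_irrelevance (subset_trans (subset_trans _ _) _) hx).
rewrite !(Prop_irrelevance (subset_trans (subset_trans _ _) _) hy).
case: (b _) => bx /= ebx; case: (b _) => by_ /= eby.
have := congr1 (mres D hx) ebx; have := congr1 (mres D hy) eby.
rewrite (triv_res _ _ _ hx) (triv_res _ _ _ hy) /dual_map /= !srestr_res !mres_trans.
rewrite (Prop_irrelevance (subset_trans hy _) (subset_trans hx (@subsetT _ _))) => <-.
(* The expression of [t] at y is moved into the trivialization at x, whose injectivity then compares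
   the coefficients of eps. *)
have := hphi (@subset_refl _ _) (Dual (srestr (cap (coc_cover z) i)) (mres E hy by_)).
rewrite (Prop_irrelevance (subset_trans _ _) hx) (Prop_irrelevance (subset_trans _ _) hy).
move=> -> /(bij_inj (triv_bij _ _))/(congr1 (@im _)) /= ->.
by rewrite addrAC subrr add0r.
Qed.

(** If z_xy(s) = c_y - c_x on the finer cover, the local lifts phi_x(s - eps c_x) agree on overlaps
    and glue in the sheaf [D]. *)
Lemma extends_of_cup_coboundary (sE : is_sheaf (ab_of_mod E))
  (V : Defs.cover X) (h : refines V (coc_cover z)) :
  is_coboundary (cochain_res h (cup_cochain z s)) -> extends_to D s.
Proof.
case=> b hb.
pose c x : E (V x) := mres E (@sub_cap_point _ V x) (b (fun=> x)).
pose t x : D (V x) := triv (phi x) (h x) (Dual (srestr _) (- c x)).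
have [||u [ut _]] := @def_is_sheaf _ _ _ D (opensT X) X V (fun x => @subsetT _ (V x)) _ t.
- by move=> x _; exists x; exact: cov_mem.
- move=> x y; rewrite /= /t.
  set W := opensI (V x) (V y); set kx : (W `<=` V x)%classic := @subIsetl _ _ _.
  set ky : (W `<=` V y)%classic := @subIsetr _ _ _.
  rewrite (triv_res _ _ _ (subset_trans kx (h x))) (triv_res _ _ _ (subset_trans ky (h y))).
  rewrite /dual_map /= !srestr_res !raddfN /=.
  have kV := sub_cap_pair kx ky.
  have kU := subset_trans kV (cap_refines h _).
  have := hphi kU (Dual (srestr W) (- mres E ky (c y))).
  (* This is the coboundary hypothesis at (x, y), restricted to [W]. *)
  have -> : endo_fun (coc z (pair_index x y)) kU (srestr W) =
      mres E ky (c y) - mres E kx (c x).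
    rewrite /c !mres_trans.
    have := @cech_d0E _ (ab_of_mod E) V b (pair_index x y) W kV kx ky.
    rewrite -hb => <-.
    rewrite /cochain_res /cup_cochain res_trans /=.
    by rewrite (endo_res _ _ _ kU) srestr_res.
  rewrite (_ : _ + _ = Dual (srestr W) (- mres E kx (c x))); last first.
    by congr Dual; rewrite /= ?addr0 // addKr.
  move=> e; symmetry; move: e.
  rewrite (Prop_irrelevance (subset_trans kU (cap_in _ (pair_index x y) ord_max))
    (subset_trans ky (h y))).
  by rewrite (Prop_irrelevance (subset_trans kU (cap_in _ (pair_index x y) ord0))
    (subset_trans kx (h x))).
(* The glued section reduces to [s] on every [V x], hence globally. *)
exists u; apply: (sheaf_separated sE) => x _.
exists (V x), (@subsetT _ (V x)); split; first exact: cov_mem.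
by rewrite /= -def_pi_res ut /t triv_pi.
Qed.

End Transition.
End Extension.

(** * The sheaf glued from a cocycle of endomorphisms *)

Section Gluing.
Variables (X : topologicalType) (O : ring_presheaf X) (E : mod_presheaf O).
Variables (z : cocycle (End_sheaf E) 1).
Implicit Types (x y w : X) (U V W : opens X).
Local Notation C := (coc_cover z).

(** The operator z_xy on E(V). The inclusions into [C x] and [C y] are separate arguments, so that
    identities between several indices can share them. *)
Definition transition x y V (h : (V `<=` C x)%classic) (k : (V `<=` C y)%classic)
    (m : E V) : E V :=
  endo_fun (coc z (pair_index x y)) (sub_cap_pair h k) m.

Lemma transitionE (s : 'I_2 -> X) V (l : (V `<=` cap C s)%classic)
  (h : (V `<=` C (s ord0))%classic) (k : (V `<=` C (s ord_max))%classic) (m : E V) :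
  endo_fun (coc z s) l m = transition h k m.
Proof.
rewrite /transition; move: (sub_cap_pair h k).
by rewrite -pair_index_eta => l'; rewrite (Prop_irrelevance l l').
Qed.

Lemma transition_res x y V W (h : (V `<=` C x)%classic) (k : (V `<=` C y)%classic)
  (i : (W `<=` V)%classic) (h' : (W `<=` C x)%classic) (k' : (W `<=` C y)%classic) m :
  mres E i (transition h k m) = transition h' k' (mres E i m).
Proof. exact: endo_res. Qed.

Lemma transitionD x y V (h : (V `<=` C x)%classic) (k : (V `<=` C y)%classic) m n :
  transition h k (m + n) = transition h k m + transition h k n.
Proof. exact: endo_funD. Qed.

Lemma transitionZ x y V (h : (V `<=` C x)%classic) (k : (V `<=` C y)%classic) a m :
  transition h k (a *: m) = a *: transition h k m.
Proof. exact: endo_funZ. Qed.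

Lemma transitionN x y V (h : (V `<=` C x)%classic) (k : (V `<=` C y)%classic) m :
  transition h k (- m) = - transition h k m.
Proof. by rewrite -scaleN1r transitionZ scaleN1r. Qed.

Lemma transition0 x y V (h : (V `<=` C x)%classic) (k : (V `<=` C y)%classic) :
  transition h k 0 = 0.
Proof. exact: endo_fun0. Qed.

(** The cocycle condition at (x, y, w), evaluated at [m], reads z_yw(m) - z_xw(m) + z_xy(m) = 0. *)
Lemma transition_cocycle x y w V (h : (V `<=` C x)%classic) (k : (V `<=` C y)%classic)
  (l : (V `<=` C w)%classic) m :
  transition h l m = transition h k m + transition k l m.
Proof.
(* The default [x] of [nth] is never reached, the index being below 3. *)
pose s : 'I_3 -> X := fun i => nth x [:: x; y; w] i.
have hs : (V `<=` cap C s)%classic.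
  by move=> v Vv; case=> [[|[|[|i]]] hi] //; [exact: h|exact: k|exact: l].
have := congr1 (endo_eval hs m) (coc_d z s).
rewrite /cech_d raddf_sum 3!big_ord_recl big_ord0 !raddfMz /=.
rewrite expr0 expr1 expr2 mulrNN mulr1 !mulr1z mulrN1z addr0 /endo_eval /=.
by rewrite !transitionE addrCA addrC => /subr0_eq <-; exact: addrC.
Qed.

(** The cocycle identity at (x, x, x) reads z_xx = z_xx + z_xx. *)
Lemma transition_id x V (h k : (V `<=` C x)%classic) m : transition h k m = 0.
Proof.
rewrite (Prop_irrelevance k h).
by apply: (addrI (transition h h m)); rewrite -transition_cocycle addr0.
Qed.

(* The sections over W of the deformation glued from the E|_(C x) + eps E|_(C x):
   [base] is the reduction modulo eps, and [corr x] the coefficient of eps in the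
   trivialization over [C x]. *)
Record glued W := Glued {
  base : E W;
  corr : forall x, E (opensI W (C x));
  corr_glue : forall x y V (h : (V `<=` opensI W (C x))%classic)
    (k : (V `<=` opensI W (C y))%classic) (l : (V `<=` W)%classic)
    (hx : (V `<=` C x)%classic) (hy : (V `<=` C y)%classic),
    mres E h (corr x) = mres E k (corr y) + transition hx hy (mres E l base) }.

Section GluedModule.
Variable W : opens X.
Implicit Types t u : glued W.

Lemma glued_eq t u : base t = base u -> (forall x, corr t x = corr u x) -> t = u.
Proof.
case: t u => [b c g] [b' c' g'] /= bb' cc'; subst b'.
have {}cc' : c = c' by exact: functional_extensionality_dep.
by subst c'; rewrite (Prop_irrelevance g g').
Qed.

HB.instance Definition _ := gen_eqMixin (glued W).
HB.instance Definition _ := gen_choiceMixin (glued W).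

Definition glued0 : glued W.
Proof.
apply: (@Glued W 0 (fun=> 0)) => x y V h k l hx hy.
by rewrite !raddf0 transition0 addr0.
Defined.

Definition glued_opp t : glued W.
Proof.
apply: (@Glued W (- base t) (fun x => - corr t x)) => x y V h k l hx hy.
by rewrite !raddfN /= (corr_glue t h k l hx hy) transitionN opprD.
Defined.

Definition glued_add t u : glued W.
Proof.
apply: (@Glued W (base t + base u) (fun x => corr t x + corr u x)) => x y V h k l hx hy.
rewrite !raddfD /= (corr_glue t h k l hx hy) (corr_glue u h k l hx hy).
by rewrite transitionD addrACA.
Defined.

Lemma glued_addA : associative glued_add.
Proof. by move=> f g k; apply: glued_eq => [|x] /=; rewrite addrA. Qed.
Lemma glued_addC : commutative glued_add.
Proof. by move=> f g; apply: glued_eq => [|x] /=; rewrite addrC. Qed.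
Lemma glued_add0 : left_id glued0 glued_add.
Proof. by move=> f; apply: glued_eq => [|x] /=; rewrite add0r. Qed.
Lemma glued_addN : left_inverse glued0 glued_opp glued_add.
Proof. by move=> f; apply: glued_eq => [|x] /=; rewrite addNr. Qed.

HB.instance Definition _ :=
  GRing.isZmodule.Build (glued W) glued_addA glued_addC glued_add0 glued_addN.

(** In each trivialization this is (a0 + eps a1)(m0 + eps m1) = a0 m0 + eps (a0 m1 + a1 m0). The
    term a1 m0 is common to all of them, so linearity of the transitions preserves the gluing
    relation. *)
Definition glued_scale (a : dual (O W)) t : glued W.
Proof.
apply: (@Glued W (re a *: base t)
  (fun x => rres O (@subIl _ W (C x)) (re a) *: corr t x
          + rres O (@subIl _ W (C x)) (im a) *:
            mres E (@subIl _ W (C x)) (base t)))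
  => x y V h k l hx hy.
rewrite !raddfD /= !mresZ !(rres_comp _ _ l) !(mres_comp _ _ l).
by rewrite (corr_glue t h k l hx hy) transitionZ scalerDr addrAC.
Defined.

Lemma glued_scaleA a b t : glued_scale a (glued_scale b t) = glued_scale (a * b) t.
Proof.
apply: glued_eq => [|x] /=; first by rewrite scalerA.
rewrite mresZ scalerDr !scalerA -addrA -scalerDl.
by rewrite rmorphM rmorphD /= !rmorphM.
Qed.
Lemma glued_scale1 : left_id 1 glued_scale.
Proof.
move=> t; apply: glued_eq => [|x] /=; first by rewrite scale1r.
by rewrite rmorph1 rmorph0 scale1r scale0r addr0.
Qed.
Lemma glued_scaleDr : right_distributive glued_scale +%R.
Proof.
move=> a t u; apply: glued_eq => [|x] /=; first by rewrite scalerDr.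
by rewrite [mres _ _ _]raddfD /= !scalerDr addrACA.
Qed.
Lemma glued_scaleDl t : {morph glued_scale^~ t : a b / a + b}.
Proof.
move=> a b; apply: glued_eq => [|x] /=; first by rewrite scalerDl.
by rewrite !rmorphD /= !scalerDl addrACA.
Qed.

HB.instance Definition _ :=
  GRing.Zmodule_isLmodule.Build (dual (O W)) (glued W)
    glued_scaleA glued_scale1 glued_scaleDr glued_scaleDl.

End GluedModule.

Lemma subIS V W x : (V `<=` W)%classic -> (opensI V (C x) `<=` opensI W (C x))%classic.
Proof. by move=> h v [Vv Cv]; split=> //; exact: h. Qed.

Definition glued_res V W (h : (W `<=` V)%classic) (t : glued V) : glued W.
Proof.
apply: (@Glued W (mres E h (base t)) (fun x => mres E (@subIS _ _ x h) (corr t x)))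
  => x y Z i k l hx hy.
by rewrite !mres_trans; exact: corr_glue.
Defined.

Lemma glued_res_additive V W (h : (W `<=` V)%classic) : zmod_morphism (glued_res h).
Proof. by move=> t u; apply: glued_eq => [|x] /=; rewrite raddfB. Qed.

HB.instance Definition _ V W (h : (W `<=` V)%classic) :=
  GRing.isZmodMorphism.Build (glued V) (glued W) (glued_res h) (glued_res_additive h).

Lemma glued_resZ V W (h : (W `<=` V)%classic) (a : dual (O V)) (t : glued V) :
  glued_res h (a *: t) = dual_map (rres O h) a *: glued_res h t.
Proof.
apply: glued_eq => [|x] /=; first by rewrite mresZ.
rewrite raddfD /= !mresZ.
rewrite !(rres_comp _ _ (subset_trans (@subIS _ _ x h) (@subIl _ V (C x)))).
by rewrite !(mres_comp _ _ (subset_trans (@subIS _ _ x h) (@subIl _ V (C x)))).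
Qed.

Lemma glued_res_id V (h : (V `<=` V)%classic) (t : glued V) : glued_res h t = t.
Proof. by apply: glued_eq => [|x] /=; rewrite mres_id. Qed.

Lemma glued_res_comp U V W (h : (V `<=` U)%classic) (k : (W `<=` V)%classic)
  (l : (W `<=` U)%classic) (t : glued U) :
  glued_res k (glued_res h t) = glued_res l t.
Proof. by apply: glued_eq => [|x] /=; exact: mres_comp. Qed.

Definition glued_sheaf : mod_presheaf (dual_sheaf O) :=
  @ModPresheaf X (dual_sheaf O) (fun W => glued W : lmodType (dual (O W)))
    (fun V W h => glued_res h : {additive glued V -> glued W})
    glued_resZ glued_res_id glued_res_comp.

(** * Trivializations of the glued sheaf and the axioms of a deformation *)

Section Triv.
Variable x : X.

(** A section r + eps i in the trivialization at x has correction i + z_yx(r) at y; these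
    corrections are compatible because z_yx = z_yw + z_wx. *)
Definition glued_triv V (h : (V `<=` C x)%classic) (m : dual (E V)) : glued V.
Proof.
apply: (@Glued V (re m) (fun y =>
  mres E (@subIl _ V (C y)) (im m)
  + transition (@subIr _ V (C y))
      (subset_trans (@subIl _ V (C y)) h)
      (mres E (@subIl _ V (C y)) (re m))))
  => y w W i k l hy hw.
have hx := subset_trans l h.
rewrite !raddfD /= !(mres_comp _ _ l).
rewrite (transition_res _ _ i hy hx) (transition_res _ _ k hw hx) !(mres_comp _ _ l).
by rewrite (transition_cocycle hy hw hx) -addrA [X in _ + X]addrC.
Defined.

Lemma glued_triv_additive V (h : (V `<=` C x)%classic) : zmod_morphism (glued_triv h).
Proof.
move=> m n; apply: glued_eq => [//|y] /=.
rewrite !raddfB /= transitionD transitionN.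
by rewrite opprD addrACA.
Qed.

HB.instance Definition _ V (h : (V `<=` C x)%classic) :=
  GRing.isZmodMorphism.Build (dual (E V)) (glued V) (glued_triv h) (glued_triv_additive h).

Lemma glued_trivZ V (h : (V `<=` C x)%classic) (a : dual (O V)) (m : dual (E V)) :
  glued_triv h (a *: m) = a *: glued_triv h m.
Proof.
apply: glued_eq => [//|y] /=.
by rewrite raddfD /= !mresZ transitionZ scalerDr addrAC.
Qed.

(** As [V] lies in [C x], the inverse can read off the correction at x over all of [V]. One
    composite is the identity because z_xx = 0, the other because z_xy + z_yx = z_xx = 0. *)
Lemma glued_triv_bij V (h : (V `<=` C x)%classic) : bijective (glued_triv h).
Proof.
exists (fun t => Dual (base t) (mres E (subI (@subset_refl _ V) h) (corr t x))).
  case=> r i; congr Dual => /=.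
  rewrite raddfD /= (transition_res _ _ _ h h) transition_id addr0.
  by rewrite mres_trans mres_id.
move=> t; apply: glued_eq => [//|y] /=.
rewrite mres_trans.
set l := @subIl _ V (C y); set hx := subset_trans l h.
set i := subset_trans l _.
rewrite (corr_glue t i (@subset_refl _ _) l hx (@subIr _ V (C y))) mres_id.
by rewrite -addrA -transition_cocycle transition_id addr0.
Qed.

Lemma glued_triv_res V W (h : (V `<=` C x)%classic) (k : (W `<=` V)%classic)
  (l : (W `<=` C x)%classic) (m : dual (E V)) :
  glued_res k (glued_triv h m) = glued_triv l (dual_map (mres E k) m).
Proof.
apply: glued_eq => [//|y] /=.
rewrite raddfD /= (transition_res _ _ _ (@subIr _ W (C y)) (subset_trans (@subIl _ W (C y)) l)).
by rewrite !(mres_comp _ _ (subset_trans (@subIl _ W (C y)) k)).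
Qed.

End Triv.

(** The base and the correction at each x are sections of [E] and glue separately. The relation
    tying them together holds locally, hence globally by separation. *)
Lemma glued_is_sheaf (sE : is_sheaf (ab_of_mod E)) : is_sheaf (ab_of_mod glued_sheaf).
Proof.
move=> U I W h hW m hm.
have compat_base i j : mres E (@subIl _ (W i) (W j)) (base (m i)) =
    mres E (@subIr _ (W i) (W j)) (base (m j)).
  exact: (congr1 (@base _) (hm i j)).
have compat_corr x i j :
    mres E (@subIl _ (opensI (W i) (C x)) (opensI (W j) (C x))) (corr (m i) x) =
    mres E (@subIr _ (opensI (W i) (C x)) (opensI (W j) (C x))) (corr (m j) x).
  (* The overlap of the traces on [C x] lies in the trace of the overlap, where [hm] gives the
     equality. *)
  have l : (opensI (opensI (W i) (C x)) (opensI (W j) (C x)) `<=`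
      opensI (opensI (W i) (W j)) (C x))%classic by move=> v [[? ?] [? ?]].
  have e := congr1 (fun t => mres E l (corr t x)) (hm i j).
  rewrite /= !mres_trans in e.
  by apply: etrans (etrans e _); exact: mres_irrelevance.
have [b [hb _]] := sE U I W h hW _ compat_base.
have gl x := sE (opensI U (C x)) I (fun i => opensI (W i) (C x)) (fun i => @subIS _ _ x (h i))
  _ _ (compat_corr x).
have {}gl x : {c : E (opensI U (C x)) | forall i, mres E (@subIS _ _ x (h i)) c = corr (m i) x}.
  apply: cid; have [|c [hc _]] := gl _ x; last by exists c.
  by move=> y v [Uv Cv]; have [i Wv] := hW v Uv; exists i.
pose c x := sval (gl x).
have hc x i : mres E (@subIS _ _ x (h i)) (c x) = corr (m i) x by exact: (svalP (gl x)).
have hg x y V (i : (V `<=` opensI U (C x))%classic) (k : (V `<=` opensI U (C y))%classic)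
  (l : (V `<=` U)%classic) (hx : (V `<=` C x)%classic) (hy : (V `<=` C y)%classic) :
    mres E i (c x) = mres E k (c y) + transition hx hy (mres E l b).
  (* On the intersection of [V] with [W j] the glued data restrict to those of [m j], which satisfy
     the relation. *)
  apply: (sheaf_separated sE) => v Vv.
  have [j Wv] := hW v (l v Vv).
  exists (opensI V (W j)), (@subIl _ V (W j)); split; first by [].
  have jx := subset_trans (@subIl _ V (W j)) hx.
  have jy := subset_trans (@subIl _ V (W j)) hy.
  have sx := subI (@subIr _ V (W j)) jx; have sy := subI (@subIr _ V (W j)) jy.
  have := corr_glue (m j) sx sy (@subIr _ V (W j)) jx jy.
  rewrite -!hc -hb /= !mres_trans [mres _ _ (_ + _)]raddfD /= (transition_res _ _ _ jx jy).
  rewrite !mres_trans.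
  move=> e; apply: etrans (etrans e _); first exact: mres_irrelevance.
  congr (_ + _); first exact: mres_irrelevance.
  by congr (transition _ _ _); exact: mres_irrelevance.
exists (Glued hg); split.
  by move=> i; apply: glued_eq => [|x] /=; [exact: hb|exact: hc].
move=> t ht; apply: glued_eq => [|x] /=; apply: (sheaf_separated sE) => v.
  move=> Uv; have [i Wv] := hW v Uv; exists (W i), (h i); split => //.
  by rewrite /= hb; rewrite -(ht i).
move=> [Uv Cv]; have [i Wv] := hW v Uv; exists (opensI (W i) (C x)), (@subIS _ _ x (h i)).
by split => //; rewrite /= hc -(ht i).
Qed.

Lemma glued_base_additive W : zmod_morphism (@base W).
Proof. by []. Qed.

HB.instance Definition _ W :=
  GRing.isZmodMorphism.Build (glued W) (E W) (@base W) (@glued_base_additive W).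

(** The trivialization at x carries a local basis of [E] to a basis over the dual numbers: the
    coefficients of r + eps q come from expanding r and q separately. *)
Lemma glued_locally_free (fE : locally_free E) : locally_free glued_sheaf.
Proof.
move=> x; have [U [Ux [n [e he]]]] := fE x.
pose W := opensI U (C x); exists W; split; first by split=> //; exact: cov_mem.
pose f (i : 'I_n) : dual (E W) := Dual (mres E (@subIl _ U (C x)) (e i)) 0.
exists n, (fun i => glued_triv (@subIr _ U (C x)) (f i)) => V h m.
have hU := subset_trans h (@subIl _ U (C x)); have hx := subset_trans h (@subIr _ U (C x)).
have sumE (a : 'I_n -> dual (O V)) :
    \sum_(i < n) (a i : dual_sheaf O V) *: mres glued_sheaf h (glued_triv (@subIr _ U (C x)) (f i))
    = glued_triv hx (Dual (\sum_(i < n) re (a i) *: mres E hU (e i))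
                          (\sum_(i < n) im (a i) *: mres E hU (e i))).
  rewrite dual_sum raddf_sum; apply: eq_bigr => i _ /=.
  rewrite (glued_triv_res _ _ hx) -glued_trivZ; congr glued_triv.
  by rewrite /dual_map /f /= mres_trans raddf0; congr Dual; rewrite /= ?scaler0 ?add0r //;
    congr (_ *: _); exact: mres_irrelevance.
have [g gK Kg] := glued_triv_bij hx.
have [r [hr ur]] := he V hU (re (g m)); have [q [hq uq]] := he V hU (im (g m)).
exists (fun i => Dual (r i) (q i)); split.
  by rewrite sumE /= -hr -hq -[LHS]Kg; case: (g m).
move=> a; rewrite sumE => /(congr1 g); rewrite gK => ga.
apply: functional_extensionality_dep => i.
rewrite (ur (fun j => re (a j)) (congr1 (@re _) ga)).
by rewrite (uq (fun j => im (a j)) (congr1 (@im _) ga)); case: (a i).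
Qed.

Lemma glued_pi_surj U (m : E U) x : oset U x ->
  exists (V : opens X) (h : (V `<=` U)%classic), oset V x /\
  exists t : glued V, base t = mres E h m.
Proof.
move=> Ux; exists (opensI U (C x)), (@subIl _ U (C x)); split.
  by split=> //; exact: cov_mem.
by exists (glued_triv (@subIr _ U (C x)) (Dual (mres E (@subIl _ U (C x)) m) 0)).
Qed.

(** In a trivialization a section with zero base is eps i, that is eps times i + eps 0. Conversely,
    multiplication by eps kills the base, which then vanishes locally and so everywhere. *)
Lemma glued_pi_ker (sE : is_sheaf (ab_of_mod E)) U (t : glued U) : base t = 0 <->
  forall x, oset U x -> exists (V : opens X) (h : (V `<=` U)%classic), oset V x /\
    exists t' : glued_sheaf V, mres glued_sheaf h t = eps O V *: t'.
Proof.
split=> [t0 x Ux|ht].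
  exists (opensI U (C x)), (@subIl _ U (C x)); split; first by split=> //; exact: cov_mem.
  have [g _ Kg] := glued_triv_bij (@subIr _ U (C x)).
  pose u := glued_res (@subIl _ U (C x)) t.
  exists (glued_triv (@subIr _ U (C x)) (Dual (im (g u)) 0)).
  rewrite -[LHS](Kg u) -glued_trivZ; congr glued_triv.
  have : base (glued_triv (@subIr _ U (C x)) (g u)) = 0 by rewrite Kg /u /= t0 raddf0.
  case: (g u) => r i /= ->.
  by rewrite -[RHS]/(Dual (0 *: i) (0 *: 0 + 1 *: i)) !scale0r scale1r add0r.
apply: (sheaf_separated sE) => x Ux.
have [V [h [Vx [t' e]]]] := ht x Ux; exists V, h; split=> //.
have /= -> := congr1 (@base V) e.
by rewrite scale0r raddf0.
Qed.

Section Deform.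
Hypotheses (sE : is_sheaf (ab_of_mod E)) (fE : locally_free E).

Definition glued_deformation : deformation E :=
  @Deformation X O E glued_sheaf (glued_is_sheaf sE) (glued_locally_free fE)
    (fun U => @base U : {additive glued U -> E U})
    (fun U a m => erefl) (fun U V h m => erefl) glued_pi_surj (glued_pi_ker sE).

Definition glued_trivialization x : trivialization glued_deformation (C x) :=
  @Trivialization X O E glued_deformation (C x)
    (fun V h => glued_triv h : {additive dual (E V) -> glued V})
    (@glued_trivZ x) (@glued_triv_bij x) (@glued_triv_res x)
    (fun V h m => erefl).

(** Compared in the correction at w, with x and y the two entries of [s], the claim is z_wy = z_wx +
    z_xy. *)
Lemma glued_associated : associated glued_deformation (class z).
Proof.
exists z; split => //; exists glued_trivialization => s V h m.
apply: glued_eq => [|w] /=; first by rewrite addr0.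
set h0 := subset_trans h (cap_in _ s ord0); set h1 := subset_trans h (cap_in _ s ord_max).
set l := @subIl _ V (C w); set r := @subIr _ V (C w).
rewrite addr0 raddfD /= (transitionE h h0 h1).
rewrite (transition_res _ _ _ (subset_trans l h0) (subset_trans l h1)).
by rewrite (transition_cocycle r (subset_trans l h0)) -addrA [X in _ + X]addrC.
Qed.

End Deform.
End Gluing.

(** * Vanishing of classes and the equivalence *)

Lemma class_zero (X : topologicalType) (F : ab_presheaf X) (p : nat) (z : cocycle F p) :
  class z = zero_class F p <->
  exists (V : Defs.cover X) (h : refines V (coc_cover z)), is_coboundary (cochain_res h z).
Proof.
have res0 V (h : refines V (cover0 X)) s : cochain_res h (cocycle0 F p) s = 0.
  exact: raddf0.
rewrite class_eq; split=> [[V [h [h0 b]]]|[V [h b]]]; exists V, h.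
  by apply: coboundary_ext b => s; rewrite res0 subr0.
(* The zero cocycle lives on the cover whose members all equal X, and every cover refines it. *)
exists (fun x => @subsetT _ (V x)); apply: coboundary_ext b => s.
by rewrite res0 subr0.
Qed.

(** By [cup_class] the product can be computed with the very cocycle [z] that describes [D]. A lift
    gives a coboundary on the cover of [z]; conversely, a coboundary on any refinement gives a
    lift. *)
Lemma extends_to_cup (X : topologicalType) (O : ring_presheaf X) (E : mod_presheaf O)
  (sE : is_sheaf (ab_of_mod E)) (s : E (opensT X)) (a : 'H^1(End_sheaf E))
  (D : deformation E) :
  associated D a -> (extends_to D s <-> cup a s = zero_class (ab_of_mod E) 1).
Proof.
case=> z [<- [phi hphi]]; rewrite cup_class class_zero; split=> [ext|[V [h b]]].
  exists (coc_cover z), (fun x => @subset_refl _ _).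
  apply: coboundary_ext (cup_coboundary_of_extends hphi ext) => i.
  by rewrite /cochain_res res_id.
exact: extends_of_cup_coboundary hphi sE V h b.
Qed.

(** The two conjuncts treat both readings of the claim: for some, and for every, deformation
    associated to [a]. *)
Theorem corollary3p7 (K : closedFieldType) (charK : [pchar K] =i pred0)
  (X : ringed_space K) (hX : smooth_projective_variety X)
  (h1 : cohomology_vanishes (ab_of_ring \O_X) 1)
  (h2 : cohomology_vanishes (ab_of_ring \O_X) 2)
  (E : mod_presheaf \O_X) (sheafE : is_sheaf (ab_of_mod E)) (freeE : locally_free E)
  (s : E (opensT X)) (a : 'H^1(End_sheaf E)) :
  ((exists D : deformation E, associated D a /\ extends_to D s) <->
     cup a s = zero_class (ab_of_mod E) 1)
  /\
  (forall D : deformation E, associated D a ->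
     (extends_to D s <-> cup a s = zero_class (ab_of_mod E) 1)).
Proof.
split=> [|D Da]; last exact: extends_to_cup.
split=> [[D [Da ext]]|a0]; first exact/(extends_to_cup sheafE s Da).
(* The existential reading requires a deformation of class [a]; it is glued from a representative
   cocycle. *)
have Da := glued_associated (repr_cocycle a) sheafE freeE.
rewrite repr_cocycleK in Da.
exists (glued_deformation (repr_cocycle a) sheafE freeE); split=> //.
exact/(extends_to_cup sheafE s Da).
Qed.
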